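(* Let $K$ be a field of characteristic zero and let $\mathcal{A}_2 = K[x,y]\langle D_x, D_y\rangle$ be the Weyl algebra. Let $m,n$ be positive integers, let $L, A_0,\dots,A_{m-1}, B_0,\dots,B_{n-1}\in K[x,y]$ with $L\neq 0$, and put $$A = L D_x^m + A_{m-1}D_x^{m-1}+\cdots+A_0,\qquad B = L D_y^n + B_{n-1}D_y^{n-1}+\cdots+B_0 .$$ Let $J$ be the left ideal of $\mathcal{A}_2$ generated by $A$ and $B$. Assume that $d$ is an upper bound for the total degrees (in $x,y$) of $L$, $A_i$ and $B_j$ for all $0\le i\le m-1$ and $0\le j\le n-1$. Then for all $\alpha,\beta\in\mathbb{N}$ there exist polynomials $R_{i,j}^{(\alpha,\beta)}\in K[x,y]$ of total degree at most $d$ such that $$L D_x^\alpha D_y^\beta \equiv \sum_{i,j} R_{i,j}^{(\alpha,\beta)} D_x^i D_y^j \mod J,$$ where the finite sum is over pairs $(i,j)\in\mathbb{N}^2$ such that either $0\le i\le m-1$ and $0\le j\le n-1$, or $i+j\le \alpha+\beta-1$.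
   Context: $\mathbb{N}$ denotes the nonnegative integers. The Weyl algebra $\mathcal{A}_2 = K[x,y]\langle D_x, D_y\rangle$ consists of finite sums $\sum_{i,j\ge 0} f_{ij}D_x^iD_y^j$ with uniquely determined coefficients $f_{ij}\in K[x,y]$, with multiplication determined by $D_xD_y=D_yD_x$ and $D_x f = fD_x+\frac{\partial f}{\partial x}$, $D_y f = fD_y+\frac{\partial f}{\partial y}$ for all $f\in K[x,y]$. For $P,Q\in\mathcal{A}_2$, $P\equiv Q \mod J$ means $P-Q\in J$. The zero polynomial is considered to have total degree at most any bound. *)

(* Defs.v *)
From HB Require Import structures.
From mathcomp Require Import all_boot all_order all_algebra.
From mathcomp Require Import ssrcomplements mpoly.

Set Implicit Arguments.
Unset Strict Implicit.
Unset Printing Implicit Defensive.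

Import GRing.Theory.
Local Open Scope ring_scope.

(* An element sum f_ij Dx^i Dy^j of the Weyl algebra is encoded by its normal
   form, a polynomial in two symbols with coefficients in K[x, y]: f_ij is the
   coefficient at the multinomial (i, j).  In both rings the indeterminate of
   index ord0 belongs to x, and the one of index ord_max to y.  Only the module
   structure over K[x, y] is kept: the commutative product of polynomials is not
   the product of operators. *)
Definition weyl2 (K : fieldType) : Type := {mpoly {mpoly K[2]}[2]}.

HB.instance Definition _ (K : fieldType) :=
  GRing.Lmodule.copy (weyl2 K) {mpoly {mpoly K[2]}[2]}.

(* Left multiplication by D_i on normal forms, as dictated by the rule
   D_i f = f D_i + df/di :
     D_i (sum f_m D^m) = sum f_m D_i D^m + sum (df_m/di) D^m. *)
HB.lock Definition weyl_lderiv (K : fieldType) (i : 'I_2)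
    (Q : {mpoly {mpoly K[2]}[2]}) : {mpoly {mpoly K[2]}[2]} :=
  'X_i * Q + map_mpoly (mderiv i) Q.

Definition weyl_lmon (K : fieldType) (m : 'X_{1..2})
    (Q : {mpoly {mpoly K[2]}[2]}) : {mpoly {mpoly K[2]}[2]} :=
  iter (m ord0) (weyl_lderiv ord0) (iter (m ord_max) (weyl_lderiv ord_max) Q).

HB.lock Definition weyl_mul (K : fieldType)
    (P Q : {mpoly {mpoly K[2]}[2]}) : {mpoly {mpoly K[2]}[2]} :=
  \sum_(m <- msupp P) P@_m *: weyl_lmon m Q.

Section WeylProduct.

Variable K : fieldType.

Local Notation R := {mpoly K[2]}.
Local Notation S := {mpoly R[2]}.

Lemma weyl_lderivE i (Q : S) :
  weyl_lderiv i Q = 'X_i * Q + map_mpoly (mderiv i) Q.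
Proof. by rewrite weyl_lderiv.unlock. Qed.

Lemma weyl_mulE (P Q : S) :
  weyl_mul P Q = \sum_(m <- msupp P) P@_m *: weyl_lmon m Q.
Proof. by rewrite weyl_mul.unlock. Qed.

Lemma weyl_lderiv_is_additive i : zmod_morphism (@weyl_lderiv K i).
Proof.
move=> P Q; rewrite !weyl_lderivE mulrBr raddfB /=.
by rewrite opprD addrACA.
Qed.

HB.instance Definition _ i :=
  GRing.isZmodMorphism.Build S S (@weyl_lderiv K i) (weyl_lderiv_is_additive i).

Lemma mcoeff_map_mderiv i (Q : S) m :
  (map_mpoly (mderiv i) Q)@_m = mderiv i Q@_m.
Proof. exact: mcoeff_map_mpoly. Qed.

Lemma weyl_lderivZ i (f : R) (Q : S) :
  weyl_lderiv i (f *: Q) = f *: weyl_lderiv i Q + mderiv i f *: Q.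
Proof.
rewrite !weyl_lderivE scalerDr -addrA -scalerAr; congr (_ + _).
apply/mpolyP=> m; rewrite mcoeff_map_mderiv mcoeffD !mcoeffZ mcoeff_map_mderiv.
by rewrite mderivM addrC.
Qed.

Lemma map_mderivMX i (Q : S) (m : 'X_{1..2}) :
  map_mpoly (mderiv i) ('X_[m] * Q) = 'X_[m] * map_mpoly (mderiv i) Q.
Proof.
elim/mpolyind: Q => [|c k Q _ _ IH]; first by rewrite mulr0 raddf0 mulr0.
rewrite mulrDr 2!raddfD /= mulrDr IH; congr (_ + _).
rewrite -scalerAr -mpolyXD.
have mapZX (a : R) (l : 'X_{1..2}) :
    map_mpoly (mderiv i) (a *: 'X_[l] : S) = mderiv i a *: 'X_[l].
  apply/mpolyP=> j; rewrite mcoeff_map_mderiv !mcoeffZ mcoeffX.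
  by case: (l == j); rewrite ?mulr1 ?mulr0 ?raddf0.
by rewrite !mapZX -scalerAr mpolyXD.
Qed.

Lemma weyl_lderivC i j (Q : S) :
  weyl_lderiv i (weyl_lderiv j Q) = weyl_lderiv j (weyl_lderiv i Q).
Proof.
have expand k l : weyl_lderiv k (weyl_lderiv l Q) =
    ('X_k * ('X_l * Q) + 'X_k * map_mpoly (mderiv l) Q) +
    ('X_l * map_mpoly (mderiv k) Q
     + map_mpoly (mderiv k) (map_mpoly (mderiv l) Q)).
  by rewrite (weyl_lderivE k) (weyl_lderivE l) raddfD /= map_mderivMX mulrDr.
have derivC : map_mpoly (mderiv i) (map_mpoly (mderiv j) Q) =
              map_mpoly (mderiv j) (map_mpoly (mderiv i) Q).
  apply/mpolyP=> m.
  have coef2 k l : (map_mpoly (mderiv k) (map_mpoly (mderiv l) Q))@_m =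
                   mderiv k (mderiv l Q@_m).
    exact: etrans (mcoeff_map_mderiv _ _ _)
                  (congr1 (mderiv k) (mcoeff_map_mderiv _ _ _)).
  exact: etrans (coef2 _ _) (etrans (mderiv_comm _ _ _) (esym (coef2 _ _))).
have swap (a b c e a' e' : S) :
    a = a' -> e = e' -> a + b + (c + e) = a' + c + (b + e').
  by move=> -> ->; rewrite addrACA.
apply: etrans (expand i j) (etrans _ (esym (expand j i))).
exact: swap (mulrCA _ _ _) derivC.
Qed.

Lemma weyl_lmon_is_additive m : zmod_morphism (@weyl_lmon K m).
Proof.
have addI i k : zmod_morphism (iter k (@weyl_lderiv K i)).
  by elim: k => // k IH P Q; rewrite !iterS IH raddfB.
by move=> P Q; rewrite /weyl_lmon !addI.
Qed.

HB.instance Definition _ m :=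
  GRing.isZmodMorphism.Build S S (@weyl_lmon K m) (weyl_lmon_is_additive m).

Lemma weyl_lmon0 (Q : S) : weyl_lmon 0%MM Q = Q.
Proof. by rewrite /weyl_lmon !mnm0E. Qed.

Lemma weyl_lmonS i m (Q : S) :
  weyl_lmon (U_(i) + m)%MM Q = weyl_lderiv i (weyl_lmon m Q).
Proof.
have iterC j k l (P : S) : iter k (weyl_lderiv j) (weyl_lderiv l P) =
                   weyl_lderiv l (iter k (weyl_lderiv j) P).
  by elim: k => //= k ->; rewrite weyl_lderivC.
rewrite /weyl_lmon !mnmDE !mnm1E.
case: i => [[|[|//]] lt_i] /=; rewrite ?add0n ?add1n ?iterS //=.
- by rewrite (_ : Ordinal lt_i = ord0) //; apply: val_inj.
- by rewrite (_ : Ordinal lt_i = ord_max) ?iterC //; apply: val_inj.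
Qed.

Lemma weyl_mulwE k (P Q : S) : (msize P <= k)%N ->
  weyl_mul P Q = \sum_(m : 'X_{1..2 < k}) P@_m *: weyl_lmon m Q.
Proof.
move=> le_Pk; pose I : subFinType _ := 'X_{1..2 < k}.
rewrite weyl_mulE (big_mksub I) /=; first last.
  by move=> m /msize_mdeg_lt /leq_trans; apply.
  by rewrite msupp_uniq.
rewrite big_rmcond //= => i; move/memN_msupp_eq0 => ->.
by rewrite scale0r.
Qed.

Lemma weyl_mulZDl (f : R) (P1 P2 Q : S) :
  weyl_mul (f *: P1 + P2) Q = f *: weyl_mul P1 Q + weyl_mul P2 Q.
Proof.
pose k := maxn (msize (f *: P1 + P2)) (maxn (msize P1) (msize P2)).
rewrite !(@weyl_mulwE k) ?leq_max ?leqnn ?orbT // scaler_sumr -big_split /=.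
by apply: eq_bigr => m _; rewrite mcoeffD mcoeffZ scalerDl scalerA.
Qed.

Lemma weyl_mul0l (Q : S) : weyl_mul 0 Q = 0.
Proof. by rewrite weyl_mulE msupp0 big_nil. Qed.

Lemma weyl_mulDl : left_distributive (@weyl_mul K) +%R.
Proof. by move=> P1 P2 Q; have := weyl_mulZDl 1 P1 P2 Q; rewrite !scale1r. Qed.

Lemma weyl_mulZl (f : R) (P Q : S) : f *: weyl_mul P Q = weyl_mul (f *: P) Q.
Proof. by have := weyl_mulZDl f P 0 Q; rewrite weyl_mul0l !addr0. Qed.

Lemma weyl_mulDr : right_distributive (@weyl_mul K) +%R.
Proof.
move=> P Q1 Q2; rewrite !weyl_mulE -big_split /=.
by apply: eq_bigr => m _; rewrite raddfD scalerDr.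
Qed.

Lemma weyl_mulX m (Q : S) : weyl_mul 'X_[m] Q = weyl_lmon m Q.
Proof. by rewrite weyl_mulE msuppX big_seq1 mcoeffX eqxx scale1r. Qed.

Lemma weyl_lderivX i (m : 'X_{1..2}) :
  weyl_lderiv i ('X_[m] : S) = 'X_[U_(i) + m].
Proof.
rewrite weyl_lderivE -mpolyXD -[RHS]addr0; congr (_ + _).
apply/mpolyP=> j; rewrite mcoeff_map_mderiv mcoeffX mcoeff0.
by rewrite -mpolyC_nat mderivC.
Qed.

Lemma weyl_mul_lderiv i (P Q : S) :
  weyl_mul (weyl_lderiv i P) Q = weyl_lderiv i (weyl_mul P Q).
Proof.
elim/mpolyind: P => [|c m P _ _ IH].
  by rewrite raddf0 weyl_mul0l raddf0.
rewrite raddfD /= !weyl_mulDl raddfD /= IH; congr (_ + _).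
rewrite -weyl_mulZl weyl_mulX !weyl_lderivZ weyl_mulDl -!weyl_mulZl.
by rewrite weyl_lderivX !weyl_mulX -weyl_lmonS.
Qed.

Lemma weyl_mulA : associative (@weyl_mul K).
Proof.
have lmonM m (Q T : S) : weyl_mul (weyl_lmon m Q) T = weyl_lmon m (weyl_mul Q T).
  have iterM i k (P : S) : weyl_mul (iter k (weyl_lderiv i) P) T =
                     iter k (weyl_lderiv i) (weyl_mul P T).
    by elim: k => //= k IH; rewrite weyl_mul_lderiv IH.
  by rewrite /weyl_lmon !iterM.
move=> P Q T; elim/mpolyind: P => [|c m P _ _ IH]; first by rewrite !weyl_mul0l.
rewrite !weyl_mulDl IH; congr (_ + _).
by rewrite -!weyl_mulZl !weyl_mulX lmonM.
Qed.

Lemma weyl_mul1l : left_id 1 (@weyl_mul K).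
Proof. by move=> Q; rewrite -mpolyX0 weyl_mulX weyl_lmon0. Qed.

Lemma weyl_lmon1 m : weyl_lmon m (1 : S) = 'X_[m].
Proof.
have iterX i k l : iter k (weyl_lderiv i) ('X_[l] : S) = 'X_[U_(i) *+ k + l].
  elim: k => [|k IH] /=; first by rewrite mulm0n add0m.
  by rewrite IH weyl_lderivX mulmS addmA.
rewrite /weyl_lmon -mpolyX0 !iterX addm0; congr 'X_[_].
apply/mnmP=> i; rewrite mnmDE !mulmnE !mnm1E.
case: i => [[|[|//]] lt_i] /=; rewrite ?muln0 ?muln1 ?mul0n ?mul1n ?add0n ?addn0.
- by congr (m _); apply: val_inj.
- by congr (m _); apply: val_inj.
Qed.

Lemma weyl_mul1r : right_id 1 (@weyl_mul K).
Proof.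
move=> P; rewrite weyl_mulE [RHS]mpolyE.
by apply: eq_bigr => m _; rewrite weyl_lmon1.
Qed.

End WeylProduct.

HB.instance Definition _ (K : fieldType) :=
  GRing.Zmodule_isNzRing.Build (weyl2 K)
    (@weyl_mulA K) (@weyl_mul1l K) (@weyl_mul1r K)
    (@weyl_mulDl K) (@weyl_mulDr K) (oner_neq0 _).

HB.instance Definition _ (K : fieldType) :=
  GRing.Lmodule_isLalgebra.Build {mpoly K[2]} (weyl2 K) (@weyl_mulZl K).

HB.lock Definition Dx (K : fieldType) : weyl2 K := 'X_(ord0 : 'I_2).
HB.lock Definition Dy (K : fieldType) : weyl2 K := 'X_(ord_max : 'I_2).
Arguments Dx {K}.
Arguments Dy {K}.

Section WeylTheory.

Variable K : fieldType.

Local Notation R := {mpoly K[2]}.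
Local Notation W := (weyl2 K).

Lemma weyl_scalarM (f g : R) : f%:A * g%:A = (f * g)%:A :> W.
Proof. by rewrite -scalerAl mul1r scalerA. Qed.

Lemma weyl_scaleE (f : R) (P : W) : f *: P = f%:A * P.
Proof. by rewrite -scalerAl mul1r. Qed.

Lemma DxE (Q : W) : Dx * Q = weyl_lderiv ord0 Q.
Proof.
by rewrite Dx.unlock [LHS]weyl_mulX -[U_(_)%MM]addm0 weyl_lmonS weyl_lmon0.
Qed.

Lemma DyE (Q : W) : Dy * Q = weyl_lderiv ord_max Q.
Proof.
by rewrite Dy.unlock [LHS]weyl_mulX -[U_(_)%MM]addm0 weyl_lmonS weyl_lmon0.
Qed.

Lemma DxDyC : Dx * Dy = Dy * Dx :> W.
Proof.
by rewrite -[Dx]mulr1 -[Dy]mulr1 -!mulrA !mul1r !DxE !DyE; exact: weyl_lderivC.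
Qed.

Lemma Dx_scalar (f : R) : Dx * f%:A = f *: Dx + (mderiv ord0 f)%:A :> W.
Proof. by rewrite DxE weyl_lderivZ -DxE mulr1. Qed.

Lemma Dy_scalar (f : R) : Dy * f%:A = f *: Dy + (mderiv ord_max f)%:A :> W.
Proof. by rewrite DyE weyl_lderivZ -DyE mulr1. Qed.

Lemma weyl_monomialE (m : 'X_{1..2}) :
  Dx ^+ m ord0 * Dy ^+ m ord_max = 'X_[m] :> W.
Proof.
have powx k (Q : W) : Dx ^+ k * Q = iter k (weyl_lderiv ord0) Q.
  by elim: k => [|k IH]; rewrite ?mul1r // exprS -mulrA IH DxE.
have powy k (Q : W) : Dy ^+ k * Q = iter k (weyl_lderiv ord_max) Q.
  by elim: k => [|k IH]; rewrite ?mul1r // exprS -mulrA IH DyE.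
by rewrite -[Dy ^+ _]mulr1 powx powy; exact: weyl_lmon1.
Qed.

(* Existence and uniqueness of the coefficients f_ij. *)
Lemma weyl_normal_form (P : W) :
  P = \sum_(m <- msupp P) P@_m *: (Dx ^+ m ord0 * Dy ^+ m ord_max).
Proof.
rewrite [LHS]mpolyE; apply: eq_bigr => m _.
by rewrite weyl_monomialE.
Qed.

Lemma weyl_coef_unique (r : seq 'X_{1..2}) (c : 'X_{1..2} -> R) (m : 'X_{1..2}) :
  uniq r -> m \in r ->
  (\sum_(k <- r) c k *: (Dx ^+ k ord0 * Dy ^+ k ord_max) : W)@_m = c m.
Proof.
move=> r_uniq rm; under eq_bigr do rewrite weyl_monomialE.
rewrite (bigD1_seq m) //= mcoeffD mcoeffZ mcoeffX eqxx mulr1.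
rewrite (raddf_sum (mcoeff m)) /= big1 ?addr0 // => k /negPf nkm.
by rewrite mcoeffZ mcoeffX nkm mulr0.
Qed.

End WeylTheory.

(* Membership of P in the left ideal W A + W B generated by A and B. *)
Definition in_lideal2 (W : nzRingType) (A B P : W) : Prop :=
  exists U V : W, P = U * A + V * B.

Lemma in_lideal2_min (W : nzRingType) (A B : W) (I : W -> Prop) :
    I A -> I B ->
    (forall P Q, I P -> I Q -> I (P + Q)) -> (forall U P, I P -> I (U * P)) ->
  forall P, in_lideal2 A B P -> I P.
Proof. by move=> IA IB ID IM _ [U [V ->]]; apply: ID; apply: IM. Qed.

Lemma in_lideal2_gens (W : nzRingType) (A B : W) :
  in_lideal2 A B A /\ in_lideal2 A B B.
Proof. by split; [exists 1, 0 | exists 0, 1]; rewrite mul1r mul0r ?addr0 ?add0r. Qed.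

Lemma in_lideal2D (W : nzRingType) (A B P Q : W) :
  in_lideal2 A B P -> in_lideal2 A B Q -> in_lideal2 A B (P + Q).
Proof.
move=> [U [V ->]] [U' [V' ->]]; exists (U + U'), (V + V').
by rewrite !mulrDl addrACA.
Qed.

Lemma in_lideal2M (W : nzRingType) (A B U P : W) :
  in_lideal2 A B P -> in_lideal2 A B (U * P).
Proof. by move=> [V [V' ->]]; exists (U * V), (U * V'); rewrite mulrDr !mulrA. Qed.

(* Main.v *)
Require Import Defs.
From mathcomp Require Import all_boot all_order all_algebra.
From mathcomp Require Import mpoly.

Import GRing.Theory.
Local Open Scope ring_scope.

(* If alpha < m and beta < n there is nothing to do.  If, say, alpha >= m, then
   Dx^(alpha - m) Dy^beta A lies in J and its normal form is L Dx^alpha Dy^beta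
   plus terms of order below alpha + beta: moving a derivation across a
   coefficient either raises the order by one or differentiates the coefficient,
   so the order lost is never regained and the degrees stay at most d. *)

(** * Order and coefficient degree under derivations *)

(** A monomial [k] of the derivative can only come from [k + U_(i)] in [p]. *)
Lemma mderiv_msize_le (n : nat) (R : nzRingType) (i : 'I_n) (p : {mpoly R[n]}) :
  (msize (mderiv i p) <= msize p)%N.
Proof.
rewrite [X in (X <= _)%N]msizeE; apply/bigmax_leqP_seq => k k_in _.
have kU_in : (k + U_(i))%MM \in msupp p.
  move: k_in; rewrite !mcoeff_msupp mcoeff_mderiv; apply: contraNneq => ->.
  by rewrite mul0rn.
by have := msize_mdeg_lt kU_in; rewrite mdegD mdeg1 addn1; apply: ltnW.
Qed.

(* msize is degree + 1, so coefficients of degree at most d correspond to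
   e = d + 1, while msize P <= k bounds the order of P by k - 1. *)
Definition order_lt (K : fieldType) (e k : nat) (P : {mpoly {mpoly K[2]}[2]}) :=
  (msize P <= k)%N /\ forall m, (msize P@_m <= e)%N.

Arguments order_lt {K} e k P.

Lemma order_lt0 (K : fieldType) (e k : nat) :
  order_lt e k (0 : {mpoly {mpoly K[2]}[2]}).
Proof. by split=> [|m]; rewrite ?mcoeff0 msize0. Qed.

Lemma order_ltD (K : fieldType) (e k : nat) (P Q : {mpoly {mpoly K[2]}[2]}) :
  order_lt e k P -> order_lt e k Q -> order_lt e k (P + Q).
Proof.
move=> [Pk Pe] [Qk Qe]; split=> [|m]; rewrite ?mcoeffD.
  by apply: leq_trans (mmeasureD_le _ _ _) _; rewrite geq_max Pk.
by apply: leq_trans (mmeasureD_le _ _ _) _; rewrite geq_max Pe Qe.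
Qed.

Lemma order_lt_sum (K : fieldType) (e k : nat) (I : eqType) (r : seq I)
    (F : I -> {mpoly {mpoly K[2]}[2]}) :
  (forall i, i \in r -> order_lt e k (F i)) -> order_lt e k (\sum_(i <- r) F i).
Proof.
move=> Fk; rewrite big_seq; elim/big_rec: _ => [|i P /Fk Fi IH].
  exact: order_lt0.
exact: order_ltD.
Qed.

Lemma order_ltZX (K : fieldType) (e k : nat) (f : {mpoly K[2]})
    (v : 'X_{1..2}) :
  (msize f <= e)%N -> (mdeg v < k)%N ->
  order_lt e k (f *: 'X_[v] : {mpoly {mpoly K[2]}[2]}).
Proof.
move=> fe vk; split=> [|m].
  by apply: leq_trans (msizeZ_le _ _) _; rewrite msizeX.
by rewrite mcoeffZ mcoeffX; case: eqP; rewrite ?mulr1 ?mulr0 ?msize0.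
Qed.

Lemma weyl_lderivZX (K : fieldType) (i : 'I_2) (f : {mpoly K[2]})
    (v : 'X_{1..2}) :
  weyl_lderiv i (f *: 'X_[v]) = f *: 'X_[U_(i) + v] + mderiv i f *: 'X_[v].
Proof. by rewrite weyl_lderivZ weyl_lderivX. Qed.

(** By Leibniz, each term [f *: 'X_[v]] yields one term of order one higher with the same
    coefficient, and one of the same order with coefficient [mderiv i f]. Hence [k] grows by one
    while [e] stays. *)
Lemma order_lt_lderiv (K : fieldType) (e k : nat) (i : 'I_2)
    (P : {mpoly {mpoly K[2]}[2]}) :
  order_lt e k P -> order_lt e k.+1 (weyl_lderiv i P).
Proof.
move=> [Pk Pe]; rewrite [P]mpolyE raddf_sum /=.
apply: order_lt_sum => v /msize_mdeg_lt vP.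
have vk : (mdeg v < k)%N by apply: leq_trans Pk.
rewrite weyl_lderivZX; apply: order_ltD; apply: order_ltZX => //.
- by rewrite mdegD mdeg1.
- exact: leq_trans (mderiv_msize_le _ _ _ _) _.
- exact: ltnW.
Qed.

(** Induction adapted to [weyl_lmonS], which peels off one derivation at a time. *)
Lemma multinom_ind (n : nat) (T : 'X_{1..n} -> Prop) :
  T 0%MM -> (forall i u, T u -> T (U_(i) + u)%MM) -> forall u, T u.
Proof.
move=> T0 TS u; move: {2}(mdeg u) (erefl (mdeg u)) => k.
elim: k u => [|k IH] u udeg.
  by move/eqP: udeg; rewrite mdeg_eq0 => /eqP ->.
have [i ui] : exists i, (0 < u i)%N.
  apply/existsP; apply: contra_eqT udeg => /existsPn u0.
  by rewrite mdegE big1 // => i _; apply/eqP; rewrite -leqn0 leqNgt u0.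
have uE : u = (U_(i) + (u - U_(i)))%MM.
  by rewrite addmC submK // lep1mP -lt0n.
rewrite uE; apply/TS/IH/succn_inj; rewrite -udeg [in RHS]uE.
by rewrite mdegD mdeg1.
Qed.

Lemma order_lt_lmon (K : fieldType) (e k : nat) (u : 'X_{1..2})
    (P : {mpoly {mpoly K[2]}[2]}) :
  order_lt e k P -> order_lt e (mdeg u + k) (weyl_lmon u P).
Proof.
move=> Pk; elim/multinom_ind: u => [|i u IH].
  by rewrite mdeg0 weyl_lmon0.
by rewrite mdegD mdeg1 weyl_lmonS -addnA add1n; apply: order_lt_lderiv.
Qed.

Lemma order_lt_lmon_leading (K : fieldType) (e : nat) (f : {mpoly K[2]})
    (u v : 'X_{1..2}) :
  (msize f <= e)%N ->
  order_lt e (mdeg u + mdeg v) (weyl_lmon u (f *: 'X_[v]) - f *: 'X_[u + v]).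
Proof.
move=> fe; elim/multinom_ind: u => [|i u IH].
  by rewrite weyl_lmon0 add0m subrr; apply: order_lt0.
(* The expected leading term is split off before the next derivation. Its new top term cancels,
   leaving [mderiv i f *: 'X_[u + v]], of order one below the new leading one. *)
rewrite weyl_lmonS -[weyl_lmon u _](subrK (f *: 'X_[u + v])) raddfD /=.
rewrite weyl_lderivZX addmA -addrA addrAC subrr add0r addrC.
rewrite mdegD mdeg1 add1n addSn; apply: order_ltD; last exact: order_lt_lderiv.
apply: order_ltZX; last by rewrite mdegD.
exact: leq_trans (mderiv_msize_le _ _ _ _) _.
Qed.

(** The argument of [weyl_lmon] has the shape of a generator: leading term plus lower terms [Q],
    whose order rises by at most [mdeg u]. *)
Lemma order_lt_reduction (K : fieldType) (e : nat) (f : {mpoly K[2]})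
    (u v : 'X_{1..2}) (Q : {mpoly {mpoly K[2]}[2]}) :
  (msize f <= e)%N -> order_lt e (mdeg v) Q ->
  order_lt e (mdeg u + mdeg v)
    (weyl_lmon u (f *: 'X_[v] + Q) - f *: 'X_[u + v]).
Proof.
move=> fe Qv; rewrite raddfD /= addrAC; apply: order_ltD.
  exact: order_lt_lmon_leading.
exact: order_lt_lmon.
Qed.

(** * Exponent pairs and double sums *)

Definition mnm2 (i j : nat) : 'X_{1..2} := [multinom [tuple i; j]].

Lemma mnm2_0 i j : mnm2 i j ord0 = i. Proof. by rewrite multinomE. Qed.
Lemma mnm2_1 i j : mnm2 i j ord_max = j. Proof. by rewrite multinomE. Qed.

Lemma mnm2_eta (u : 'X_{1..2}) : mnm2 (u ord0) (u ord_max) = u.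
Proof.
apply/mnmP => i; have [->|->] : i = ord0 \/ i = ord_max.
- by case: i => [[|[|//]] lt_i]; [left | right]; apply: val_inj.
- by rewrite mnm2_0.
- by rewrite mnm2_1.
Qed.

Lemma mnm2D i j k l : (mnm2 i j + mnm2 k l)%MM = mnm2 (i + k) (j + l).
Proof. by rewrite -[LHS]mnm2_eta !mnmDE !mnm2_0 !mnm2_1. Qed.

Lemma mdeg_mnm2 i j : mdeg (mnm2 i j) = (i + j)%N.
Proof.
rewrite mdegE !big_ord_recl big_ord0 addn0 mnm2_0 -[in RHS](mnm2_1 i j).
by congr (_ + mnm2 i j _)%N; apply: val_inj.
Qed.

Lemma weyl_mnm2E (K : fieldType) (i j : nat) :
  Dx ^+ i * Dy ^+ j = 'X_[mnm2 i j] :> weyl2 K.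
Proof. by rewrite -weyl_monomialE mnm2_0 mnm2_1. Qed.

(** Passes from a normal form to the double sum of the theorem: box terms outside the support have
    coefficient zero. *)
Lemma weyl_sum_box (K : fieldType) (M N : nat) (c : nat -> nat -> bool)
    (P : weyl2 K) :
  (forall u, u \in msupp P ->
    [&& u ord0 < M, u ord_max < N & c (u ord0) (u ord_max)]%N) ->
  P = \sum_(i < M) \sum_(j < N | c i j) P@_(mnm2 i j) *: (Dx ^+ i * Dy ^+ j).
Proof.
move=> suppP; apply/mpolyP => u; rewrite (raddf_sum (mcoeff u)) /=.
have coefE i j : (P@_(mnm2 i j) *: (Dx ^+ i * Dy ^+ j) : weyl2 K)@_u =
    P@_(mnm2 i j) * (mnm2 i j == u)%:R.
  by rewrite weyl_mnm2E mcoeffZ mcoeffX.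
under eq_bigr => i _ do rewrite (raddf_sum (mcoeff u)) /=.
under eq_bigr => i _ do under eq_bigr => j _ do rewrite coefE.
have [/suppP /and3P[u0 u1 cu]|] := boolP (u \in msupp P); last first.
  move/memN_msupp_eq0 => Pu; rewrite Pu big1 // => i _; rewrite big1 // => j _.
  by case: eqP => [->|_]; rewrite ?Pu ?mulr0 ?mul0r.
rewrite (bigD1 (Ordinal u0)) //= (bigD1 (Ordinal u1)) //= mnm2_eta eqxx mulr1.
rewrite !big1 ?addr0 // => [i ni|j /andP[_ nj]].
  rewrite big1 // => j _; case: eqP => [iu|]; rewrite ?mulr0 //.
  by case/eqP: ni; apply: val_inj; rewrite /= -iu mnm2_0.
case: eqP => [iu|]; rewrite ?mulr0 //.
by case/eqP: nj; apply: val_inj; rewrite /= -iu mnm2_1.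
Qed.

(** * Reduction modulo the left ideal *)

(** The exponents [w] are left abstract to cover the lower terms of both [A], in powers of [Dx], and
    [B], in powers of [Dy]. *)
Lemma order_lt_generator (K : fieldType) (e k : nat) (a : 'I_k -> {mpoly K[2]})
    (w : nat -> 'X_{1..2}) :
  (forall i, mdeg (w i) = i) -> (forall i, (msize (a i) <= e)%N) ->
  order_lt e (mdeg (w k))
    (\sum_(i < k) a i *: 'X_[w i] : {mpoly {mpoly K[2]}[2]}).
Proof.
move=> wE ae; apply: order_lt_sum => i _.
by apply: order_ltZX => //; rewrite !wE.
Qed.

Lemma in_lideal2_lmon (K : fieldType) (A B T : weyl2 K) (u : 'X_{1..2}) :
  in_lideal2 A B T -> in_lideal2 A B (weyl_lmon u T).
Proof. by rewrite -weyl_mulX; apply: (@in_lideal2M (weyl2 K) A B 'X_[u] T). Qed.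

Theorem lemma1p2 (K : fieldType) (charK0 : [pchar K] =i pred0)
    (m n : nat) (m_gt0 : (0 < m)%N) (n_gt0 : (0 < n)%N)
    (L : {mpoly K[2]}) (a : 'I_m -> {mpoly K[2]}) (b : 'I_n -> {mpoly K[2]})
    (L_neq0 : L != 0) (A B : weyl2 K)
    (defA : A = L *: Dx ^+ m + \sum_(i < m) a i *: Dx ^+ i)
    (defB : B = L *: Dy ^+ n + \sum_(j < n) b j *: Dy ^+ j)
    (d : nat) (degL : (msize L <= d.+1)%N)
    (dega : forall i, (msize (a i) <= d.+1)%N)
    (degb : forall j, (msize (b j) <= d.+1)%N)
    (alpha beta : nat) :
  exists R : nat -> nat -> {mpoly K[2]},
    (forall i j, (msize (R i j) <= d.+1)%N) /\
    in_lideal2 A B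
      (L *: (Dx ^+ alpha * Dy ^+ beta) -
       \sum_(i < m + (alpha + beta)) \sum_(j < n + (alpha + beta) |
           ((i < m)%N && (j < n)%N) || (i + j < alpha + beta)%N)
         R i j *: (Dx ^+ i * Dy ^+ j)).
Proof.
(* Every pair satisfying [c] lies within the summation bounds, so these only make the sum finite. *)
pose c i j := ((i < m) && (j < n) || (i + j < alpha + beta))%N.
pose lead : weyl2 K := L *: 'X_[mnm2 alpha beta].
pose box (u : 'X_{1..2}) := [&& u ord0 < m + (alpha + beta),
  u ord_max < n + (alpha + beta) & c (u ord0) (u ord_max)]%N.
pose remainder (P : weyl2 K) := [/\ forall u, u \in msupp P -> box u,
  forall u, (msize P@_u <= d.+1)%N & in_lideal2 A B (lead - P)].
suff [P [Pbox Pe PJ]] : exists P, remainder P.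
  exists (fun i j => P@_(mnm2 i j)); split=> [i j|]; first exact: Pe.
  rewrite [P in lead - P](weyl_sum_box _ _ _ _ _ Pbox) in PJ.
  by rewrite weyl_mnm2E.
(* For [P = - (T - lead)] the difference [lead - P] is [T] itself; the order bound puts the support
   of [P] in the second alternative of [c]. *)
have reduced (T : weyl2 K) : in_lideal2 A B T ->
    order_lt d.+1 (alpha + beta) (T - lead) -> exists P, remainder P.
  move=> TJ [Tk Te]; exists (- (T - lead)); split=> [u|u|].
  - rewrite (perm_mem (msuppN _)) => /msize_mdeg_lt /leq_trans /(_ Tk).
    rewrite -[u]mnm2_eta mdeg_mnm2 => lt_u.
    rewrite /box /c mnm2_0 mnm2_1 lt_u orbT andbT.
    apply/andP; split; apply: ltn_addl; apply: leq_ltn_trans lt_u.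
      exact: leq_addr.
    exact: leq_addl.
  - by rewrite mcoeffN mmeasureN; apply: Te.
  - by rewrite opprK addrC subrK.
have [alpha_lt|alpha_ge] := ltnP alpha m; last first.
  (* Here [T] is [A] multiplied by the monomial of exponent [(alpha - m, beta)]; adding [(m, 0)]
     gives [(alpha, beta)]. *)
  have := order_lt_generator K d.+1 m a (mnm2^~ 0%N).
  move/(_ (fun i => etrans (mdeg_mnm2 i 0) (addn0 i)) dega).
  move/(order_lt_reduction _ _ _ (mnm2 (alpha - m) beta) _ _ degL).
  rewrite -mdegD mnm2D subnK // addn0 mdeg_mnm2 => ord_A.
  apply: reduced (in_lideal2_lmon _ A B A (mnm2 (alpha - m) beta) _) _.
    by case: (in_lideal2_gens A B).
  suff -> : A = L *: 'X_[mnm2 m 0] + \sum_(i < m) a i *: 'X_[mnm2 i 0] by [].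
  rewrite defA -weyl_mnm2E mulr1.
  by under [in RHS]eq_bigr do rewrite -weyl_mnm2E mulr1.
have [beta_lt|beta_ge] := ltnP beta n; last first.
  have := order_lt_generator K d.+1 n b (mnm2 0%N).
  move/(_ (fun j => mdeg_mnm2 0 j) degb).
  move/(order_lt_reduction _ _ _ (mnm2 alpha (beta - n)) _ _ degL).
  rewrite -mdegD mnm2D subnK // addn0 mdeg_mnm2 => ord_B.
  apply: reduced (in_lideal2_lmon _ A B B (mnm2 alpha (beta - n)) _) _.
    by case: (in_lideal2_gens A B).
  suff -> : B = L *: 'X_[mnm2 0 n] + \sum_(j < n) b j *: 'X_[mnm2 0 j] by [].
  rewrite defB -weyl_mnm2E mul1r.
  by under [in RHS]eq_bigr do rewrite -weyl_mnm2E mul1r.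
exists lead; split=> [u|u|].
- move/msuppZ_le; rewrite msuppX inE => /eqP ->.
  rewrite /box /c mnm2_0 mnm2_1 alpha_lt beta_lt.
  by rewrite (ltn_addr _ alpha_lt) (ltn_addr _ beta_lt).
(* Only the coefficient bound is extracted; [ltnSn] merely supplies some order bound. *)
- by case: (order_ltZX K d.+1 _ L (mnm2 alpha beta) degL (ltnSn _)).
- by exists 0, 0; rewrite subrr !mul0r addr0.
Qed.
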